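(* Let $G$ be a finite group with a normal subgroup $N$ such that $G/N$ is nilpotent. Suppose that every minimal subgroup of $F^{*}(N)$ is contained in the center $Z(G)$ and that every cyclic subgroup of $F^{*}(N)$ of order $4$ is weakly $S\Phi$-supplemented in $G$. Then $G$ is nilpotent.
   Context: All groups are finite. A minimal subgroup is a subgroup of prime order. $F^{*}(N)=E(N)F(N)$ is the generalized Fitting subgroup of $N$, where $F(N)$ is the Fitting subgroup and $E(N)$ is the subgroup generated by all components (subnormal quasisimple subgroups) of $N$. A subgroup $A$ of $G$ is $S$-permutable in $G$ if $AQ=QA$ for all Sylow subgroups $Q$ of $G$ (for all primes). For a subgroup $H\le G$, $H_{sG}$ denotes the subgroup of $H$ generated by all subgroups of $H$ which are $S$-permutable in $G$. $\Phi(H)$ denotes the Frattini subgroup of $H$. A subgroup $H$ of $G$ is weakly $S\Phi$-supplemented in $G$ if there exists a subgroup $T$ of $G$ such that $G=HT$ and $H\cap T\le \Phi(H)H_{sG}$. *)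

(* Defs.v *)
From mathcomp Require Import all_boot all_fingroup all_solvable.

Set Implicit Arguments.
Unset Strict Implicit.
Unset Printing Implicit Defensive.

Local Open Scope group_scope.

Section Defs.

Variable gT : finGroupType.
Implicit Types (G N H A L : {group gT}).

(* [Sylow G Q] says that Q is a Sylow p-subgroup of G for some prime p; the
   trivial group may also qualify, but it permutes with everything. *)
Definition s_permutable A G : bool :=
  (A \subset G) && [forall Q : {group gT}, Sylow G Q ==> (A * Q == Q * A)].

(* H_{sG} *)
Definition s_core H G : {set gT} :=
  <<\bigcup_(A : {group gT} | (A \subset H) && s_permutable A G) A>>.

Definition weakly_sPhi_supplemented H G : Prop :=
  exists T : {group gT},
    [/\ T \subset G, H * T = G & H :&: T \subset 'Phi(H) * s_core H G].

Definition quasisimple L : bool := (L^`(1) == L) && simple (L / 'Z(L)).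

Definition component L N : bool := (L <|<| N) && quasisimple L.

(* E(N) *)
Definition layer N : {set gT} :=
  <<\bigcup_(L : {group gT} | component L N) L>>.

(* F^*(N) *)
Definition gen_Fitting N : {set gT} := layer N * 'F(N).

Lemma layer_sub N : layer N \subset N.
Proof.
rewrite gen_subG; apply/bigcupsP=> L /andP[snLN _].
exact: subnormal_sub.
Qed.

Lemma gen_FittingY N : gen_Fitting N = layer N <*> 'F(N).
Proof.
rewrite /gen_Fitting -norm_joinEl //.
exact: subset_trans (layer_sub N) (gFnorm _ _).
Qed.

Lemma gen_Fitting_group_set N : group_set (gen_Fitting N).
Proof. by rewrite gen_FittingY; apply: groupP. Qed.

Canonical gen_Fitting_group N := Group (gen_Fitting_group_set N).

End Defs.

(* Main.v *)
Require Import Defs.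
From mathcomp Require Import all_boot all_fingroup all_solvable.
From mathcomp Require vcharacter.

(** Throughout, an element is small if its order is a prime or 4.

    The hypotheses on [F^*(N)] are used in a single way: a small element [x] of
    [F^*(N)] that lies in [G'] is centralised by every subgroup [Q] of [G] of
    order coprime to [#[x]].  For [x] of prime order this holds because [x] is
    central.  If [H = <[x]>] has order 4, then ['Phi(H)] has order 2 and is
    central, so a supplement [T] of [H] that does not contain [H] yields the
    subgroup ['Phi(H) T] of index 2; it contains [G'], hence [H], which is
    absurd.  So [H <= T], and the supplement condition forces [H] to be
    S-permutable in [G].  Then [H <= 'O_2(G)], so [H] is normal, as
    ['O_2(G) :&: HS], in each product [HS] with [S] a Sylow subgroup of odd
    order; as [Aut H] has order 2, [S] centralises [H].

    This is applied twice.
    - [N] has no component [L].  Indeed [L] is perfect, so it lies in [G'], and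
      each of its small elements is centralised by the subgroups of [L] of
      coprime order.  A group with this property is nilpotent
      ([nilpotent_of_small_order_centralised]): in a minimal counterexample all
      proper subgroups are nilpotent, so that the group is solvable by Schmidt's
      theorem ([minimal_nonnilpotent_sol]).  Consequently
      ['C_N('F(N)) <= 'F(N)].
    - Every [p']-subgroup [Q] of [G] centralises [P = 'O_p(N)].  Indeed
      [[P, Q] <= G'], and a [p']-group centralising the small elements of a
      [p]-group centralises that [p]-group; so [Q] centralises [[P, Q]], and
      hence [P], by coprime action.

    The second point makes [G / 'C_G('O_p(N))] a [p]-group for each [p] and
    places ['F(N)] in the hypercentre of [G].  If [H <= [H, G]], then [H] dies
    in every nilpotent quotient, so [H] lies in [N] and centralises each
    ['O_p(N)]; by the first point [H] lies in ['F(N)], hence in the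
    hypercentre, and is trivial.  Thus [G] is nilpotent. *)

Set Implicit Arguments.
Unset Strict Implicit.
Unset Printing Implicit Defensive.

Local Open Scope group_scope.

(** * Coprime action and small elements *)

Section CoprimeAction.

Variable gT : finGroupType.
Implicit Types (A P : {group gT}).

(** If [y = [~ x, a]] commutes with [a], then [y ^+ #[a] = [~ x, a ^+ #[a]]] is
    trivial; the order of [y] divides two coprime numbers.  This is
    [[P, A, A] = [P, A]] in the form in which it is needed. *)
Lemma coprime_commg_fix P A :
    A \subset 'N(P) -> coprime #|P| #|A| -> A \subset 'C([~: P, A]) ->
  A \subset 'C(P).
Proof.
move=> nPA coPA cRA; apply/centsP=> a Aa x Px; apply/commgP.
have Rxa: [~ x, a] \in [~: P, A] by rewrite mem_commg.
have cxa: commute a [~ x, a] by apply: (centsP cRA).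
have /eqP: [~ x, a] ^+ #[a] = 1 by rewrite -commgX // expg_order commg1.
rewrite -order_dvdn => dv1.
have dv2: #[[~ x, a]] %| #|P|.
  by apply: order_dvdG; apply: subsetP Rxa; rewrite commg_subl.
have := coprime_dvdl dv2 (coprime_dvdr (order_dvdG Aa) coPA).
rewrite /coprime (gcdn_idPl dv1) order_eq1 => /eqP xa1.
by rewrite -invg_comm xa1 invg1.
Qed.

(** In the abelian case [[P, A]] meets ['C(A)] trivially, so it cannot contain
    an element of prime order. *)
Lemma coprime_abelian_cent_prime_order P A :
    abelian P -> A \subset 'N(P) -> coprime #|P| #|A| ->
    (forall x, x \in P -> prime #[x] -> A \subset 'C[x]) ->
  A \subset 'C(P).
Proof.
move=> abP nPA coPA cA; have tiR := coprime_abel_cent_TI nPA coPA abP.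
apply: coprime_commg_fix => //; have [->|ntR] := eqVneq [~: P, A] 1.
  exact: cents1.
have pr_p: prime (pdiv #|[~: P, A]|) by rewrite pdiv_prime // cardG_gt1.
have [x Rx ox] := Cauchy pr_p (pdiv_dvd _).
have sRP: [~: P, A] \subset P by rewrite commg_subl.
have cxA: x \in 'C(A).
  by rewrite -sub_cent1 cA ?(subsetP sRP) // ox.
have: x \in 'C_[~: P, A](A) by rewrite inE Rx.
by rewrite tiR => /set1P x1; rewrite x1 order1 in ox; rewrite -ox in pr_p.
Qed.

(** Let [K] be a critical subgroup of [P].  As [K / 'Z(K)] is elementary abelian
    and [K] has class at most 2, the abelian case for ['Z(K)] shows that [A]
    fixes [p]-th powers of elements of [K].  So for [x] in [K] the quotient of
    [x ^ a] by [x] has order dividing [p], or 4 if [p = 2]: it is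
    trivial or small, hence fixed by [A], and [A] centralises [K].  Since [K] is
    critical, [A] then centralises [P]. *)
Lemma coprime_pgroup_cent_small_order (p : nat) P A :
    p.-group P -> A \subset 'N(P) -> coprime #|P| #|A| ->
    (forall x, x \in P -> prime #[x] || (#[x] == 4) -> A \subset 'C[x]) ->
  A \subset 'C(P).
Proof.
move=> pP nPA coPA cA; have [K [chK sPhiZ sRZ CPK]] := Thompson_critical pP.
have [sKP nKP] := andP (char_normal chK).
have nKA: A \subset 'N(K) := char_norm_trans chK nPA.
have [P1 | ntP] := eqVneq P 1%G; first by rewrite P1 cents1.
have [pr_p _ _] := pgroup_pdiv pP ntP.
have coKA: coprime #|K| #|A| := coprimeSg sKP coPA.
have pK := pgroupS sKP pP.
have sZK : 'Z(K) \subset K := center_sub K.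
have cZA: A \subset 'C('Z(K)).
  apply: coprime_abelian_cent_prime_order.
  - exact: center_abelian.
  - exact: char_norm_trans (center_char K) nKA.
  - exact: coprimeSg sZK coKA.
  move=> x Zx pr_x; apply: cA; last by rewrite pr_x.
  by rewrite (subsetP sKP) ?(subsetP sZK).
have XpZ x : x \in K -> x ^+ p \in 'Z(K).
  move=> Kx; apply: (subsetP sPhiZ); rewrite (Phi_joing pK).
  apply: (subsetP (joing_subr _ _)).
  by rewrite (MhoE 1 pK) mem_gen //; apply/imsetP; exists x.
have cKA: A \subset 'C(K).
  apply: coprime_commg_fix => //.
  rewrite centsC gen_subG; apply/subsetP=> _ /imset2P[x a Kx Aa ->].
  set u := [~ x, a].
  have Kxa : x ^ a \in K by rewrite memJ_norm ?(subsetP nKA).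
  have Ku: u \in K by rewrite /u commgEl groupM ?groupV.
  have [u1 | ntu] := eqVneq u 1; first by rewrite u1 group1.
  set z := [~ x ^ a, x^-1].
  have Zz: z \in 'Z(K).
    apply: (subsetP sRZ); apply: (subsetP (commSg _ sKP)).
    by rewrite mem_commg ?groupV.
  have cz y : y \in K -> commute y z.
    by case/centerP: Zz => _ cz Ky; apply/esym/cz.
  have zp: z ^+ p = 1.
    rewrite -commXg; last exact: cz.
    apply/eqP/commgP; case/centerP: (XpZ _ Kxa) => _; apply.
    by rewrite groupV.
  (* By the collection formula in class 2; the two [p]-th powers cancel because
     [a] fixes [x ^+ p]. *)
  have up: u ^+ p = z ^+ 'C(p, 2).
    rewrite /u commgEl expMg_Rmul; [|apply: cz => //|apply: cz]; last first.
      by rewrite groupV.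
    rewrite -conjXg (conjg_fixP _) ?expgVn ?mulVg ?mul1g //.
    by apply/commgP/esym; apply: (centsP cZA) => //; apply: XpZ.
  rewrite -sub_cent1; apply: cA; first exact: subsetP sKP _ Ku.
  have [p2|op] := even_prime pr_p; last first.
    have: u ^+ p == 1.
      by rewrite up bin2odd // expgM zp expg1n.
    rewrite -order_dvdn => dv_up; have [_ p_div] := primeP pr_p.
    case/orP: (p_div _ dv_up) => /eqP ou; last by rewrite ou pr_p.
    by case/eqP: ntu; apply/eqP; rewrite -order_eq1 ou.
  have: u ^+ 4 == 1 by rewrite (expgM u 2 2) -p2 up p2 /= binn expg1 -p2 zp.
  rewrite -order_dvdn dvdn_divisors // !inE order_eq1 (negPf ntu) /=.
  by case/orP=> /eqP->.
(* From [K] to [P]: the three subgroup lemma puts [[P, A]] in ['C_P(K)], which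
   is ['Z(K)] as [K] is critical. *)
apply: coprime_commg_fix => //.
suffices sRZ': [~: P, A] \subset 'Z(K).
  by rewrite centsC (subset_trans sRZ') // centsC.
rewrite -CPK subsetI commg_subl nPA /=.
apply/commG1P; rewrite [[~: P, A]]commGC; apply: three_subgroup.
  apply/commG1P; rewrite centsC (subset_trans cKA) // centS //.
  by rewrite (subset_trans sRZ).
have -> : [~: K, A] = 1 by apply/commG1P; rewrite centsC.
exact: comm1G.
Qed.

End CoprimeAction.

(** * Groups all of whose proper subgroups are nilpotent *)

Section MinimalNonnilpotent.

(** Two cases, according to whether distinct maximal subgroups always intersect
    trivially.  If so, a maximal subgroup is a Frobenius complement, and the
    Frobenius kernel contradicts simplicity.  If not, take [M1 != M2] maximal
    with the largest intersection [D]; normalisers grow in [M1] and [M2], so a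
    maximal subgroup containing ['N_G(D)] meets each of them in more than [D]
    and must be equal to both. *)
Lemma simple_with_nilpotent_subgroups_sol (gT : finGroupType) (G : {group gT}) :
    simple G -> (forall H : {group gT}, H \proper G -> nilpotent H) ->
  solvable G.
Proof.
move=> /simpleP[ntG simG] nilG; apply: contraT => nsolG.
have nabG : ~~ abelian G by apply: contra nsolG; apply: abelian_sol.
have ntmax (M : {group gT}) : maximal M G -> M :!=: 1.
  move=> /maxgroupP[_ maxM]; apply: contra nabG => /eqP M1.
  have [x Gx ntx] := trivgPn _ ntG.
  apply: cyclic_abelian; apply/cyclicP; exists x.
  apply/eqP; rewrite eqEsubset cycle_subG Gx andbT; apply: contraR ntx => nGx.
  rewrite -cycle_eq1 -M1; apply/eqP; apply: maxM; last by rewrite M1 sub1G.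
  by rewrite properE cycle_subG Gx.
have normMax (D : {group gT}) : D :!=: 1 -> D \proper G -> 'N_G(D) \proper G.
  move=> ntD pD; rewrite properE subsetIl subsetI subxx /=.
  apply/negP=> nDG; have nsDG: D <| G by rewrite /normal (proper_sub pD).
  have [D1|DG] := simG _ nsDG; first by rewrite D1 eqxx in ntD.
  by rewrite DG properxx in pD.
have [M maxM]: {M : {group gT} | maximal M G}.
  have [|M maxM _] := @maxgroup_exists _ (fun A => A \proper G) 1%G.
    by rewrite proper1G.
  by exists M.
pose badP (i : {group gT} * {group gT}) :=
  [&& maximal i.1 G, maximal i.2 G & i.1 != i.2].
have properI (i : {group gT} * {group gT}) : badP i -> i.1 :&: i.2 \proper i.1.
  case/and3P=> /maxgroupP[_ max1] /maxgroupP[p2 _] ne12.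
  rewrite properE subsetIl subsetI subxx /=; apply: contra ne12 => s12.
  by apply/eqP/val_inj/esym/max1.
have [tiMax | ] := boolP [forall i, badP i ==> (i.1 :&: i.2 == 1)].
  have sMG := proper_sub (maxgroupp maxM).
  have frobG: [Frobenius G with complement M].
    apply/andP; split; first by rewrite (proper_neq (maxgroupp maxM)).
    apply/normedTI_P; split; first by rewrite setD_eq0 subG1 (ntmax _ maxM).
      by rewrite subsetI sMG normD1 normG.
    move=> g Gg; rewrite -setI_eq0 conjD1g -setDIl setD_eq0 subG1 => ntI.
    have maxMg: maximal (M :^ g)%G G by rewrite -(conjGid Gg) maximalJ.
    have [eqM|neM] := eqVneq M (M :^ g)%G; last first.
      have := forallP tiMax (M, (M :^ g)%G); rewrite /badP /= maxM maxMg neM /=.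
      by rewrite (negPf ntI).
    have: g \in 'N_G(M) by rewrite inE Gg; apply/normP/esym/(congr1 val eqM).
    suffices ->: 'N_G(M) = M by [].
    case/maxgroupP: (maxM) => pM maxM'; apply: maxM' => //.
      by apply: normMax; rewrite ?ntmax.
    by rewrite subsetI sMG normG.
  have [K frobK] := vcharacter.Frobenius_kernel_exists frobG.
  have [defG ntK _ pKG _] := Frobenius_context frobK.
  have [nsKG _ _ _ _] := sdprod_context defG.
  case: (simG _ nsKG) => [K1|KG]; first by rewrite K1 eqxx in ntK.
  by rewrite KG properxx in pKG.
rewrite negb_forall => /existsP[i0]; rewrite negb_imply => bad0.
pose P i := badP i && (i.1 :&: i.2 != 1).
pose size_I (i : {group gT} * {group gT}) := #|i.1 :&: i.2|.
have [[M1 M2] Pi maxI] := @arg_maxnP _ i0 P size_I bad0.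
have{Pi} [bad12 ntD] := andP Pi; have /and3P[/= max1 max2 ne12] := bad12.
set D := (M1 :&: M2)%G; have sDM1 : D \subset M1 by apply: subsetIl.
have sDM2 : D \subset M2 by apply: subsetIr.
have pD1: D \proper M1 := properI _ bad12.
have pD2: D \proper M2.
  have := properI (M2, M1); rewrite /badP /= max1 max2 eq_sym ne12 /D /= setIC.
  exact.
have pND: 'N_G(D) \proper G.
  by apply: normMax => //; apply: proper_trans pD1 (maxgroupp max1).
have [NG|[M3 max3 sNM3]] := @maximal_exists _ 'N_G(D)%G G (subsetIl _ _).
  by rewrite NG properxx in pND.
have eqM3 (M4 : {group gT}) :
  maximal M4 G -> D \proper M4 -> M4 = M3.
- move=> max4 pD4; apply/eqP; apply: contraT => ne43.
  have pM4G := maxgroupp max4.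
  have sN43: 'N_M4(D) \subset M4 :&: M3.
    rewrite subsetI subsetIl (subset_trans _ sNM3) // setSI //.
    exact: proper_sub pM4G.
  have pDI: D \proper M4 :&: M3.
    exact: proper_sub_trans (nilpotent_proper_norm (nilG _ pM4G) pD4) sN43.
  have := maxI (M4, M3); rewrite /P /badP /size_I /= max4 max3 ne43 /=.
  have ntI: M4 :&: M3 != 1.
    by apply: contraNneq ntD => I1; rewrite -subG1 /= -I1 proper_sub.
  by move/(_ ntI); rewrite leqNgt (proper_card pDI).
by rewrite (eqM3 M1) // (eqM3 M2) // eqxx in ne12.
Qed.

(** Schmidt's theorem; induction through a proper normal subgroup reduces it to
    simple groups. *)
Theorem minimal_nonnilpotent_sol (gT : finGroupType) (G : {group gT}) :
    (forall H : {group gT}, H \proper G -> nilpotent H) -> solvable G.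
Proof.
move: {2}_.+1 (ltnSn #|G|) => n; elim: n => // n IHn in gT G *.
rewrite ltnS => leGn nilG.
have [simG | nsimG] := boolP (simple G).
  exact: simple_with_nilpotent_subgroups_sol.
have [G1 | ntG] := eqVneq (G : {set gT}) 1; first by rewrite G1 solvable1.
have [M nsMG /andP[ntM neMG]]:
  exists2 M : {group gT}, M <| G & (M :!=: 1) && (M :!=: G).
- apply/exists_inP; apply: contraR nsimG => /exists_inPn noM.
  apply/simpleP; split=> // M nsMG; apply/pred2P.
  by have := noM M nsMG; rewrite negb_and !negbK.
have [sMG nMG] := andP nsMG; have pMG : M \proper G by rewrite properEneq neMG.
rewrite (series_sol nsMG) nilpotent_sol ?nilG //=.
apply: IHn => [|Hb pHG].
  by apply: leq_trans leGn; rewrite ltn_quotient.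
have [H defH sMH sHG] := inv_quotientS nsMG (proper_sub pHG).
rewrite defH quotient_nil // nilG // properEneq sHG andbT.
by apply: contraTneq pHG => HG; rewrite defH HG properxx.
Qed.

End MinimalNonnilpotent.

(** * A criterion for nilpotency *)

Section NilpotencyCriteria.

Variable gT : finGroupType.
Implicit Types (G H K L M N P Q U X : {group gT}).

(** Nilpotency is defined by the triviality of the subgroups [H] with
    [H <= [H, G]].  This lemma and the next confine such an [H]. *)
Lemma sub_commg_nilpotent_quotient G M H :
    M <| G -> nilpotent (G / M) -> H \subset G -> H \subset [~: H, G] ->
  H \subset M.
Proof.
move=> /andP[sMG nMG] /forall_inP nilGM sHG sHR.
have nMH := subset_trans sHG nMG.
rewrite -quotient_sub1 // subG1; apply: nilGM.
by rewrite subsetI -quotientR // !quotientS.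
Qed.

Lemma sub_commg_ucn n G H :
  H \subset 'Z_n(G) -> H \subset [~: H, G] -> H :=: 1.
Proof.
move=> sHZ sHR; elim: n sHZ => [|n IHn] sHZ.
  by apply/trivgP; rewrite -(ucn0 G).
exact: IHn (subset_trans sHR (subset_trans (commSg G sHZ) (ucn_comm n G))).
Qed.

Lemma Fitting_sub_pcores N X :
  (forall p : nat, 'O_p(N) \subset X) -> 'F(N) \subset X.
Proof.
move=> sOX; rewrite -(Sylow_gen 'F(N)) gen_subG; apply/bigcupsP=> P.
case/SylowP=> p _ sylP; apply: subset_trans (sOX p).
by rewrite -p_core_Fitting (nilpotent_Hall_pcore (Fitting_nil N) sylP).
Qed.

Lemma normal_subcent_normal U G : U <| G -> 'C_G(U) <| G.
Proof.
by case/andP=> _ nUG; rewrite /normal subsetIl normsI ?normG ?norms_cent.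
Qed.

Section CentralisedPcore.

Variables (p : nat) (G U : {group gT}).
Hypotheses (nsUG : U <| G) (pU : p.-group U).
Hypothesis cUp' : forall Q, Q \subset G -> p^'.-group Q -> Q \subset 'C(U).

(** The Sylow subgroups of [G] for the primes other than [p] act trivially on
    [U]. *)
Lemma quotient_cent_pgroup : p.-group (G / 'C_G(U)).
Proof.
have nCG := normal_norm (normal_subcent_normal nsUG).
apply/pgroupP=> q pr_q; rewrite inE; apply: contraTT => ne_qp.
have [Q sylQ] := Sylow_exists q G.
have sQC: Q \subset 'C_G(U).
  rewrite subsetI (pHall_sub sylQ) cUp' ?(pHall_sub sylQ) //.
  apply: sub_in_pnat (pHall_pgroup sylQ) => r _ /eqP->.
  by rewrite !inE.
have cardQ: #|Q / 'C_G(U)| = (#|G / 'C_G(U)|`_q)%N.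
  exact: card_Hall (quotient_pHall (subset_trans (pHall_sub sylQ) nCG) sylQ).
rewrite (quotientS1 sQC) cards1 in cardQ.
by move/esym/eqP: cardQ; rewrite p_part_eq1 mem_primes pr_q cardG_gt0 /= => ->.
Qed.

(** For a Sylow [p]-subgroup [P] we have [G = 'C_G(U) P] and [U <= P], so the
    commutators of [U] with [G] are commutators with [P]; thus the upper central
    series of [P] cuts out a [G]-central series in [U].  The index [#|G|] is
    merely a bound on the class of [P] that does not depend on [p]. *)
Lemma p_normal_sub_ucn : U \subset 'Z_(#|G|)(G).
Proof.
have [P sylP] := Sylow_exists p G.
have [pP sPG] := (pHall_pgroup sylP, pHall_sub sylP).
have nCG := normal_norm (normal_subcent_normal nsUG).
have defG: G \subset 'C_G(U) * P.
  rewrite -quotientSK //.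
  have sylPC := quotient_pHall (subset_trans sPG nCG) sylP.
  by rewrite -(pHall_id sylPC quotient_cent_pgroup).
have sUP: U \subset P.
  exact: subset_trans (pcore_max pU nsUG) (pcore_sub_Hall sylP).
have ZP: 'Z_(#|G|)(P) = P.
  apply/(ucn_nil_classP _ (pgroup_nil pP)).
  apply: leq_trans (subset_leq_card sPG); apply: ltnW.
  by rewrite -nilpotent_class (pgroup_nil pP).
suffices sUZ n : U :&: 'Z_n(P) \subset 'Z_n(G).
  by apply: subset_trans (sUZ _); rewrite ZP subsetI subxx.
elim: n => [|n IHn]; first by rewrite !ucn0 subsetIr.
apply/subsetP=> x /setIP[Ux]; rewrite !ucnSnR !inE => /andP[Px sxP].
rewrite (subsetP sPG) // gen_subG.
apply/subsetP=> _ /imset2P[_ g /set1P-> Gg ->].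
have /mulsgP[c u /setIP[_ cc] Pu ->] := subsetP defG g Gg.
have -> : [~ x, c * u] = [~ x, u].
  have /commgP/eqP xc1 := esym (centP cc x Ux).
  by rewrite commgMJ xc1 conj1g mulg1.
apply: (subsetP IHn); rewrite inE (subsetP sxP) ?andbT; last first.
  by rewrite mem_commg ?set11.
rewrite commgEl groupM ?groupV // memJ_norm // (subsetP (normal_norm nsUG)) //.
exact: subsetP sPG _ Pu.
Qed.

End CentralisedPcore.

(** A subgroup [H <= [H, G]] vanishes in the nilpotent quotients of [G] by [N]
    and by each ['C_G('O_p(N))], so it lies in ['C_N('F(N))], hence in ['F(N)],
    hence in the hypercentre. *)
Theorem nilpotent_of_pcores_centralised G N :
    N <| G -> nilpotent (G / N) -> 'C_N('F(N)) \subset 'F(N) ->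
    (forall (p : nat) Q,
       Q \subset G -> p^'.-group Q -> Q \subset 'C('O_p(N))) ->
  nilpotent G.
Proof.
move=> nsNG nilGN cFF cO; apply/forall_inP=> H /subsetIP[sHG sHR].
have nsOG (p : nat) : 'O_p(N) <| G := gFnormal_trans _ nsNG.
have sHN: H \subset N := sub_commg_nilpotent_quotient nsNG nilGN sHG sHR.
have sFZ: 'F(N) \subset 'Z_(#|G|)(G).
  apply: Fitting_sub_pcores => p.
  exact: p_normal_sub_ucn (nsOG p) (pcore_pgroup _ _) (cO p).
apply/eqP; apply: sub_commg_ucn (sHR); apply: subset_trans sFZ.
apply: subset_trans cFF; rewrite subsetI sHN centsC /=.
apply: Fitting_sub_pcores => p.
have := quotient_cent_pgroup (nsOG p) (cO p).
move/pgroup_nil => nilC.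
have nsCG := normal_subcent_normal (nsOG p).
have := sub_commg_nilpotent_quotient nsCG nilC sHG sHR.
by rewrite subsetI centsC => /andP[].
Qed.
End NilpotencyCriteria.

(** * Components and small elements *)

Section SmallOrderElements.

Variable gT : finGroupType.
Implicit Types (G H K L M N P Q : {group gT}).

Lemma quasisimple_nonsol L : quasisimple L -> ~~ solvable L.
Proof.
case/andP=> /eqP perfL /simpleP[ntLZ _]; apply: contra ntLZ => solL.
have [-> | ntL] := eqVneq L 1%G; first by rewrite /= quotientS1 ?sub1G.
by have := sol_der1_proper solL (subxx L) ntL; rewrite perfL properxx.
Qed.

Lemma subnormal_nilpotent_sub_Fitting M N :
  M <|<| N -> nilpotent M -> M \subset 'F(N).
Proof.
move: {2}_.+1 (ltnSn #|N|) => n; elim: n N => // n IHn N.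
rewrite ltnS => leNn snMN nilM.
case: (subnormalEr snMN) => [MN | [K [snMK nsKN pKN]]].
  by rewrite MN Fitting_max // -MN.
have leKn : #|K| < n := leq_trans (proper_card pKN) leNn.
apply: subset_trans (IHn K leKn snMK nilM) _.
by rewrite Fitting_max ?Fitting_nil ?gFnormal_trans.
Qed.

(** If ['C_N('F(N))] is not nilpotent, a minimal non-nilpotent subnormal
    subgroup [K] of [N] inside it is a component: the proper normal subgroups of
    [K] are nilpotent, hence lie in ['F(N)], which [K] centralises. *)
Theorem cent_Fitting_sub_of_no_component N :
    (forall L, ~~ component L N) -> 'C_N('F(N)) \subset 'F(N).
Proof.
move=> noL; set C := 'C_N('F(N))%G.
have nsCN : C <| N by apply: normal_subcent_normal; apply: Fitting_normal.
have [nilC | nnilC] := boolP (nilpotent C); first exact: Fitting_max.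
pose bad (A : {set gT}) := [&& A <|<| N, A \subset C & ~~ nilpotent A].
have [|K minK sKC] := @mingroup_exists _ bad C.
  by rewrite /bad normal_subnormal ?subxx.
have [/and3P[snKN _ nnilK] minK'] := mingroupP minK.
have sKCF : K \subset 'C('F(N)) := subset_trans sKC (subsetIr _ _).
have central M : M <| K -> M :!=: K -> M \subset 'Z(K).
  move=> nsMK neMK; have sMK := normal_sub nsMK.
  have snMN := subnormal_trans (normal_subnormal nsMK) snKN.
  have nilM: nilpotent M.
    apply: contraR neMK => nnilM; apply/eqP/minK' => //.
    by rewrite /bad snMN nnilM (subset_trans sMK).
  rewrite subsetI sMK centsC (subset_trans sKCF) // centS //.
  exact: subnormal_nilpotent_sub_Fitting snMN nilM.
have ntKZ : K / 'Z(K) != 1.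
  apply: contra nnilK; rewrite -subG1 quotient_sub1 ?gFnorm //.
  move/subset_trans/(_ (subsetIr _ _)) => cKK; exact: abelian_nil.
case/negP: (noL K); rewrite /component snKN /=; apply/andP; split.
  apply: contraR nnilK => ne1; have := central _ (der_normal 1 K) ne1.
  rewrite -quotient_center_nil => sK1Z; apply: abelian_nil.
  exact: sub_der1_abelian.
apply/simpleP; split=> // Hb nsHb.
have [M -> sZM nsMK] := inv_quotientN (center_normal K) nsHb.
have [->|neMK] := eqVneq (M : {set gT}) K; [by right | left].
exact: quotientS1 (central M nsMK neMK).
Qed.

(** The hypothesis passes to subgroups, so Schmidt's theorem makes a minimal
    counterexample solvable; its Fitting subgroup is then self-centralising, and
    the small elements control the coprime action on each ['O_p(G)]. *)
Theorem nilpotent_of_small_order_centralised G :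
    (forall x Q, x \in G -> prime #[x] || (#[x] == 4) ->
       Q \subset G -> coprime #[x] #|Q| -> Q \subset 'C[x]) ->
  nilpotent G.
Proof.
move: {2}_.+1 (ltnSn #|G|) => n; elim: n G => // n IHn G.
rewrite ltnS => leGn cG.
have solG: solvable G.
  apply: minimal_nonnilpotent_sol => H pHG; apply: IHn => [|x Q Hx ox sQH].
    exact: leq_trans (proper_card pHG) leGn.
  by apply: cG => //; [apply: subsetP Hx | apply: subset_trans sQH _];
    apply: proper_sub.
apply: (@nilpotent_of_pcores_centralised _ G G) => //.
- by rewrite trivg_quotient nilpotent1.
- apply: cent_Fitting_sub_of_no_component => L; apply/negP=> /andP[snLG].
  move/quasisimple_nonsol/negP; case; apply: solvableS solG.
  exact: subnormal_sub.
move=> p Q sQG p'Q; have pO := pcore_pgroup p G.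
have coOQ: coprime #|'O_p(G)| #|Q| := pnat_coprime pO p'Q.
apply: (coprime_pgroup_cent_small_order pO _ coOQ) => [|x Ox ox].
  by rewrite (subset_trans sQG) ?gFnorm.
apply: cG => //; first exact: subsetP (pcore_sub _ _) _ Ox.
exact: coprime_dvdl (order_dvdG Ox) coOQ.
Qed.

End SmallOrderElements.

(** * Cyclic subgroups of order four *)

Section OrderFour.

Variable gT : finGroupType.
Implicit Types (A G H P Q S T : {group gT}).

(** For a Sylow [p]-subgroup [P], the product [HP] is a [p]-group, so [H <= P]. *)
Lemma s_permutable_pgroup_sub_pcore (p : nat) H G :
  p.-group H -> s_permutable H G -> H \subset 'O_p(G).
Proof.
move=> pH /andP[sHG /forall_inP permH]; apply/bigcapsP=> P maxP.
have sylP: p.-Sylow(G) P by rewrite -max_pgroup_Sylow.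
have /eqP cHP := permH P (p_Sylow sylP).
have defHP: H <*> P = H * P by rewrite comm_joingE.
have pHP: p.-group (H <*> P) by rewrite defHP pgroupM pH (pHall_pgroup sylP).
rewrite -(sub_pHall sylP pHP) ?joing_subl ?joing_subr //.
by rewrite join_subG sHG (pHall_sub sylP).
Qed.

(** For a Sylow subgroup [S] of odd order, [H] is a Sylow 2-subgroup of [HS]
    contained in ['O_2(G)], so it is normalised by [S]; and [Aut H] is a
    2-group. *)
Lemma s_permutable_cyclic4_cent H G Q :
    cyclic H -> #|H| = 4 -> s_permutable H G -> Q \subset G -> odd #|Q| ->
  Q \subset 'C(H).
Proof.
move=> cycH oH permH sQG oddQ.
have pH: 2.-group H by rewrite /pgroup oH.
have sHO := s_permutable_pgroup_sub_pcore pH permH.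
rewrite -(Sylow_gen Q) gen_subG; apply/bigcupsP=> R /SylowP[q pr_q sylR].
have [-> | ntR] := eqVneq (R : {set gT}) 1; first exact: sub1G.
have sRQ := pHall_sub sylR; have qR := pHall_pgroup sylR.
have oddq : odd q.
  have [_ q_dv _] := pgroup_pdiv qR ntR.
  exact: dvdn_odd (dvdn_trans q_dv (cardSg sRQ)) oddQ.
have [S sylS sRS] := Sylow_superset (subset_trans sRQ sQG) qR.
apply: subset_trans sRS _.
have [sHG /forall_inP/(_ S (p_Sylow sylS))/eqP cHS] := andP permH.
have qS := pHall_pgroup sylS.
have q2' : q \in 2^' by rewrite !inE; apply: contraTneq oddq => ->.
have S2' : 2^'.-group S by apply: sub_in_pnat qS => r _ /eqP->.
set K := H <*> S; have defK : H * S = K by rewrite /K comm_joingE.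
have hallH : 2.-Hall(K) H.
  by have [] := coprime_mulpG_Hall defK pH S2'.
have nHS : S \subset 'N(H).
  have -> : H :=: 'O_2(G) :&: K.
    symmetry; apply: (sub_pHall hallH) => /=; rewrite ?subsetIr //.
      exact: pgroupS (subsetIl _ _) (pcore_pgroup 2 G).
    by rewrite subsetI sHO joing_subl.
  have sSG := pHall_sub sylS.
  apply: normsI; first exact: subset_trans sSG (gFnorm _ _).
  exact/normsG/joing_subr.
have oAut: #|Aut H| = 2 by rewrite (card_Aut_cyclic cycH) oH.
have co: coprime #|conj_aut H @* S| #|S|.
  apply: pnat_coprime S2'; apply: pgroupS (Aut_conj_aut _ _) _.
  by rewrite /pgroup oAut.
have: #|conj_aut H @* S| = 1%N.
  apply/eqP; rewrite -dvdn1 -(eqnP co) dvdn_gcd dvdnn.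
  exact: dvdn_morphim.
by rewrite card_morphim ker_conj_aut (setIidPr nHS) => /eqP; rewrite indexg_eq1.
Qed.

Lemma cyclic4_Phi H :
    cyclic H -> #|H| = 4 ->
  #|'Phi(H)| = 2 /\ (forall A, A \proper H -> A \subset 'Phi(H)).
Proof.
move=> cycH oH; have pH: 2.-group H by rewrite /pgroup oH.
have card_max (M : {group gT}) : maximal M H -> #|M| = 2.
  move=> maxM; have := Lagrange (proper_sub (maxgroupp maxM)).
  rewrite (p_maximal_index pH maxM) oH => e.
  by apply/eqP; rewrite -(eqn_pmul2r (m:=2)) // e.
have subPhi A : A \proper H -> A \subset 'Phi(H).
  move=> pA; have [AH|[M maxM sAM]] := maximal_exists (proper_sub pA).
    by rewrite AH properxx in pA.
  apply/bigcapsP=> L /orP[/eqP LH | maxL]; first by rewrite LH proper_sub.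
  suffices -> : L :=: M by [].
  have [sMH sLH] := (proper_sub (maxgroupp maxM), proper_sub (maxgroupp maxL)).
  by apply/eqP; rewrite (eq_subG_cyclic cycH sLH sMH) !card_max.
split=> //.
have [H1|[M maxM _]] := maximal_exists (sub1G H).
  by rewrite -H1 cards1 in oH.
rewrite -(card_max M maxM); congr #|pred_of_set _|; apply/eqP.
rewrite eqEsubset subPhi ?(maxgroupp maxM) // andbT.
exact: Phi_sub_max.
Qed.

(** A supplement [T] not containing [H] would give ['Phi(H) T] of index 2 in [G]
    and meeting [H] in ['Phi(H)], whereas a subgroup of index 2 contains [G'].
    So [H = 'Phi(H) H_sG], and as ['Phi(H)] contains every proper subgroup of
    [H], one of the S-permutable subgroups generating [H_sG] is [H] itself. *)
Lemma weakly_sPhi_supplemented_cyclic4_s_permutable H G :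
    cyclic H -> #|H| = 4 -> 'Phi(H) \subset 'Z(G) -> H \subset G^`(1) ->
    weakly_sPhi_supplemented H G ->
  s_permutable H G.
Proof.
move=> cycH oH sPhiZ sHG1 [T [sTG defG sHT]].
have [oPhi subPhi] := cyclic4_Phi cycH oH.
have pPhi: 'Phi(H) \proper H.
  by rewrite properEcard Phi_sub oPhi oH.
have [sHT' | nsHT] := boolP (H \subset T).
  rewrite (setIidPl sHT') in sHT; apply: contraT => nperm.
  have sC: s_core H G \subset 'Phi(H).
    rewrite gen_subG; apply/bigcupsP=> A /andP[sAH permA]; apply: subPhi.
    rewrite properEneq sAH andbT; apply: contra nperm => /eqP AH.
    by rewrite -(val_inj AH).
  have := subset_trans sHT (mulgS _ sC).
  by rewrite mulGid (negPf (proper_subn pPhi)).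
have sHG : H \subset G by rewrite (subset_trans sHG1) ?der_sub.
have sHTPhi: H :&: T \subset 'Phi(H).
  by apply: subPhi; rewrite properE subsetIl subsetI subxx.
have cPhi: 'Phi(H) \subset 'C(T).
  by rewrite (subset_trans sPhiZ) // subIset // (centS sTG) orbT.
pose T1 := ('Phi(H) <*> T)%G.
have defT1: 'Phi(H) * T = T1 by rewrite /= cent_joinEl.
have defG1 : H * T1 = G.
  by rewrite -defT1 mulgA (mulGSid (Phi_sub H)).
have sT1G : T1 \subset G by rewrite -defG1 mulG_subr.
have IT1: H :&: T1 = 'Phi(H).
  rewrite -defT1 setIC -group_modl ?Phi_sub // setIC; exact: mulGSid.
have idx: #|G : T1| = 2.
  have := mul_cardG H T1; rewrite defG1 IT1 oPhi oH -(Lagrange sT1G) mulnC.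
  rewrite -mulnA => /eqP; rewrite eqn_pmul2l ?cardG_gt0 //.
  by move/eqP => e; apply/eqP; rewrite -(eqn_pmul2r (m:=2)) // -e.
have nsT1 : T1 <| G by rewrite index2_normal ?idx.
suffices sHT1: H \subset T1.
  by case/negP: (proper_subn pPhi); rewrite -IT1 subsetI subxx.
apply: subset_trans sHG1 _; rewrite der1_min ?normal_norm //.
apply/cyclic_abelian/prime_cyclic.
by rewrite card_quotient ?normal_norm // idx.
Qed.

End OrderFour.

(** * The theorem *)

Theorem theorem1p7 (gT : finGroupType) (G N : {group gT})
    (nsNG : N <| G)
    (nilGN : nilpotent (G / N))
    (minZ : forall X : {group gT},
       X \subset gen_Fitting N -> prime #|X| -> X \subset 'Z(G))
    (cyc4 : forall H : {group gT},
       H \subset gen_Fitting N -> cyclic H -> #|H| = 4 ->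
       weakly_sPhi_supplemented H G) :
  nilpotent G.
Proof.
have small_cent x (Q : {group gT}) :
    x \in gen_Fitting N -> x \in G^`(1) -> prime #[x] || (#[x] == 4) ->
  Q \subset G -> coprime #[x] #|Q| -> Q \subset 'C[x].
- move=> Fx G1x /orP[pr_x | /eqP ox] sQG co_xQ.
    have sXZ: <[x]> \subset 'Z(G) by apply: minZ; rewrite ?cycle_subG.
    rewrite sub_cent1; apply: (subsetP (centS sQG)).
    by move: sXZ; rewrite cycle_subG => /setIP[].
  have oddQ: odd #|Q|.
    by rewrite -coprime2n; apply: coprime_dvdl co_xQ; rewrite ox.
  have cycX := cycle_cyclic x; have [oPhi _] := cyclic4_Phi cycX ox.
  have sXF: <[x]> \subset gen_Fitting N by rewrite cycle_subG.
  have sPhiZ: 'Phi(<[x]>) \subset 'Z(G).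
    by apply: minZ; rewrite ?oPhi // (subset_trans (Phi_sub _)).
  have sXG1: <[x]> \subset G^`(1) by rewrite cycle_subG.
  have supX := cyc4 <[x]>%G sXF cycX ox.
  have permX: s_permutable <[x]>%G G.
    exact: weakly_sPhi_supplemented_cyclic4_s_permutable supX.
  by rewrite -cent_cycle (s_permutable_cyclic4_cent cycX ox permX).
have sLF : layer N \subset gen_Fitting N by rewrite gen_FittingY joing_subl.
have sFF : 'F(N) \subset gen_Fitting N by rewrite gen_FittingY joing_subr.
apply: (nilpotent_of_pcores_centralised nsNG nilGN).
  apply: cent_Fitting_sub_of_no_component => L; apply/negP=> compL.
  have [snLN qsL] := andP compL; have [/eqP perfL _] := andP qsL.
  have sLG: L \subset G := subset_trans (subnormal_sub snLN) (normal_sub nsNG).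
  have sLlay : L \subset layer N by apply: sub_gen; apply: (bigcup_max L).
  case/negP: (quasisimple_nonsol qsL); apply: nilpotent_sol.
  apply: nilpotent_of_small_order_centralised => x Q Lx ox sQL.
  apply: small_cent => //; last exact: subset_trans sLG.
    by rewrite (subsetP sLF) ?(subsetP sLlay).
  by rewrite (subsetP (dergS 1 sLG)) //= perfL.
move=> p Q sQG p'Q; set P := 'O_p(N).
have pP: p.-group P := pcore_pgroup p N.
have coPQ : coprime #|P| #|Q| := pnat_coprime pP p'Q.
have nsPG : P <| G := gFnormal_trans _ nsNG.
have nPQ : Q \subset 'N(P) := subset_trans sQG (normal_norm nsPG).
apply: coprime_commg_fix => //.
have sRP : [~: P, Q] \subset P by rewrite commg_subl.
have coRQ := coprimeSg sRP coPQ.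
apply: (coprime_pgroup_cent_small_order (pgroupS sRP pP)) => //.
  exact: commg_normr.
move=> x Rx ox; apply: small_cent => //.
- apply: (subsetP sFF); apply: (subsetP (pcore_sub p _)).
  by rewrite p_core_Fitting (subsetP sRP).
- by apply: subsetP Rx; rewrite commgSS // normal_sub.
exact: coprime_dvdl (order_dvdG Rx) coRQ.
Qed.
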